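(* Let $\ell$ be a positive integer. There exist real coefficients $\beta_0,\dots,\beta_{2\ell-1}$ with $|\beta_i|\le(2\ell)^{3\ell}$ for all $i$, such that for every infinitely differentiable $f:\mathbb{R}\to\mathbb{R}$, every $x\in\mathbb{R}$ and every $\delta\ge 0$, \[ \left|\sum_{i=0}^{2\ell-1}\beta_i f(x-i\delta)-\frac{d^\ell f}{dx^\ell}(x)\,\delta^\ell\right|\le(2\ell)^{3\ell+1}\delta^{2\ell}\max_{\xi\in[x-2\ell\delta,\,x]}\left|\frac{d^{2\ell}f}{dx^{2\ell}}(\xi)\right|. \] *)

(* Defs.v *)
From Stdlib Require Import Reals.
From Coquelicot Require Import Coquelicot.
Open Scope R_scope.

Definition smooth (f : R -> R) : Prop :=
  forall (n : nat) (x : R), ex_derive_n f n x.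

Definition is_max_on (g : R -> R) (a b M : R) : Prop :=
  (exists xi : R, a <= xi <= b /\ g xi = M) /\
  (forall xi : R, a <= xi <= b -> g xi <= M).

(* Main.v *)
(** Take [beta i = l! [X^l] L_i], where [L_0, ..., L_{n-1}] (with [n = 2l]) is
    the Lagrange basis at the nodes [0, -1, ..., -(n-1)].  Interpolation
    reproduces [X^j] for [j < n], so [sum_i beta_i (-i)^j = l!] if [j = l] and
    [0] otherwise: the weights annihilate every Taylor term of order below [n]
    except the [l]-th.  The coefficients of [prod_{m <> i} (X + m)] are at most
    [prod_m (1 + m) = n!] and its value at the node [-i] is a nonzero integer,
    so [|beta_i| <= l! n!].  The factor [n!] cancels the one in the Lagrange
    remainder [M (i delta)^n / n!], whence an error at most
    [n l! n^n delta^n M <= n^(3l+1) delta^n M]. *)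

Require Import Defs.
From Stdlib Require Import Reals Factorial Lra Lia.
From Coquelicot Require Import Coquelicot.
From mathcomp Require all_boot all_order all_algebra Rstruct.
Open Scope R_scope.

Module Interpolation.

Import all_boot all_order all_algebra.
Import Order.TTheory GRing.Theory Num.Theory.
Local Open Scope ring_scope.

(** Multiplying by ['X - c%:P] shifts the coefficients and subtracts [c] times the old ones, so a
    uniform bound on them grows by at most the factor [1 + |c|]. *)
Lemma coef_prod_XsubC_bound (F : numDomainType) (s : seq F) (k : nat) :
  `|(\prod_(c <- s) ('X - c%:P))`_k| <= \prod_(c <- s) (1 + `|c|).
Proof.
elim: s k => [|c s IHs] k.
  by rewrite !big_nil coef1; case: eqP; rewrite ?normr1 ?normr0.
rewrite !big_cons mulrBl coefB coefXM coefCM mulrDl mul1r.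
apply: le_trans (ler_normB _ _) _; rewrite normrM lerD //.
  by case: eqP => // _; rewrite normr0 prodr_ge0 // => d _; rewrite addr_ge0.
by rewrite ler_wpM2l.
Qed.

Definition node (F : nzRingType) (m : nat) : F := - m%:R.

Lemma node_inj (F : numDomainType) : injective (node F).
Proof. by move=> a b /oppr_inj /eqP; rewrite eqr_nat => /eqP. Qed.

Lemma node_dist_ge1 (F : numDomainType) (i j : nat) :
  i != j -> 1 <= `|node F i - node F j|.
Proof.
wlog lt_ij : i j / (i < j)%N => [IH ne_ij|_].
  case: (ltngtP i j) (ne_ij) => // ltij _; first exact: IH.
  by rewrite distrC IH // eq_sym.
by rewrite /node opprK addrC -natrB ?(ltnW lt_ij) // normr_nat ler1n subn_gt0.
Qed.
Lemma coef_lagrange_bound (F : numFieldType) (n k : nat) (i : 'I_n) :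
  `|(tnth (n.-lagrange (node F)) i : {poly F})`_k| <= n`!%:R.
Proof.
have n_gt0 : (0 < n)%N by apply: leq_ltn_trans (ltn_ord i).
rewrite (lagrangeE n_gt0 (@node_inj F)) /= coefCM normrM normfV -[leRHS]mul1r.
apply: ler_pM; rewrite ?invr_ge0 //.
  have ge1 : 1 <= `|(\prod_(j < n | j != i) ('X - (node F j)%:P)).[node F i]|.
    rewrite horner_prod normr_prod.
    elim/big_ind: _ => // [a b a1 b1|j ji]; first by rewrite -[1]mulr1 ler_pM.
    by rewrite hornerXsubC node_dist_ge1 // eq_sym.
  by rewrite invf_le1 // (lt_le_trans ltr01).
rewrite -big_filter -(big_map (fun j : 'I_n => node F j) xpredT (fun c => 'X - c%:P)).
apply: le_trans (coef_prod_XsubC_bound _ _ _) _.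
rewrite big_map big_filter.
have -> : n`!%:R = \prod_(j < n) (1 + `|node F j|).
  elim: n {n_gt0 i} => [|n IHn]; first by rewrite big_ord0.
  by rewrite big_ord_recr /= -IHn factS mulnC natrM normrN normr_nat nat1r.
(* Restoring the omitted factor at [i], which is at least 1, only enlarges the product. *)
rewrite [leRHS](bigD1 i) //= ler_peMl //.
  by apply: prodr_ge0 => j _; rewrite addr_ge0.
by rewrite lerDl.
Qed.

(** Compare the coefficients of degree [k] in the interpolation identity for ['X^j], which is exact
    since [j < n]. *)
Lemma lagrange_moment (F : numFieldType) (n j k : nat) :
  (j < n)%N ->
  \sum_(i < n) (tnth (n.-lagrange (node F)) i : {poly F})`_k * node F i ^+ j = (k == j)%:R.
Proof.
move=> lt_jn; have n_gt0 : (0 < n)%N by apply: leq_ltn_trans lt_jn.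
have sz : (size ('X^j : {poly F}) <= n)%N by rewrite size_polyXn.
have := congr1 (fun p : {poly F} => p`_k) (lagrange_gen n_gt0 (@node_inj F) sz).
rewrite coefXn coef_sum => ->; apply: eq_bigr => i _.
by rewrite hornerXn coefCM mulrC.
Qed.

Import Rstruct.

(** Restates the bound and the moments with the operations of the standard reals. There are [p.+1]
    nodes because [sum_f_R0] includes its upper index. *)
Lemma finite_difference_weights (p l : nat) :
  exists beta : nat -> R,
    (forall i : nat, (i <= p)%coq_nat ->
       Rle (Rabs (beta i)) (Rmult (INR (fact l)) (INR (fact p.+1)))) /\
    (forall j : nat, (j <= p)%coq_nat ->
       sum_f_R0 (fun i => Rmult (beta i) (pow (Ropp (INR i)) j)) p
       = if Nat.eqb j l then INR (fact l) else IZR 0).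
Proof.
exists (fun i => l`!%:R * (tnth (p.+1.-lagrange (node R)) (inord i) : {poly R})`_l).
split=> [i _|j /ssrnat.leP le_jp].
  apply/RleP; rewrite RabsE !INRE !factE RmultE normrM normr_nat.
  by rewrite ler_wpM2l // coef_lagrange_bound.
rewrite sum_f_R0E big_mkord.
have -> : (if Nat.eqb j l then INR (fact l) else IZR 0)
          = l`!%:R * (l == j)%:R :> R.
  rewrite INRE factE; case: (Nat.eqb_spec j l) => [->|/eqP ne].
    by rewrite eqxx mulr1.
  by rewrite eq_sym (negPf ne) mulr0.
rewrite -(@lagrange_moment R p.+1 j l) // mulr_sumr; apply: eq_bigr => i _.
by rewrite inord_val RmultE RpowE RoppE INRE mulrA.
Qed.

End Interpolation.
(** The reflection [t => f (- t)] turns an expansion to the left of [x] into one to the right of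
    [- x]; the signs of its derivatives are absorbed into the powers of [- h]. *)
Lemma taylor_left (f : R -> R) (n : nat) (x h M : R) :
  smooth f -> 0 <= h ->
  (forall xi, x - h <= xi <= x -> Rabs (Derive_n f (S n) xi) <= M) ->
  Rabs (f (x - h)
        - sum_f_R0 (fun j => (- h) ^ j / INR (fact j) * Derive_n f j x) n)
    <= h ^ S n / INR (fact (S n)) * M.
Proof.
  intros Hf Hh HM.
  assert (Hfact : forall k, 0 < INR (fact k)) by (intro k; apply INR_fact_lt_0).
  assert (HM0 : 0 <= M).
  { apply Rle_trans with (2 := HM x ltac:(lra)), Rabs_pos. }
  assert (Hr : 0 <= h ^ S n / INR (fact (S n))).
  { apply Rmult_le_pos; [now apply pow_le | apply Rlt_le, Rinv_0_lt_compat, Hfact]. }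
  destruct (Rle_lt_or_eq_dec 0 h Hh) as [Hpos | <-].
  - assert (Hloc : forall k y, locally (- y) (fun z : R_UniformSpace =>
        forall m : nat, (m <= k)%nat -> ex_derive_n f m z)).
    { intros k y. apply filter_forall. intros z m _. apply Hf. }
    destruct (Taylor_Lagrange (fun t => f (- t)) n (- x) (- x + h))
      as [z [Hz Heq]]; [lra | |].
    { intros t _ k _. now apply ex_derive_n_comp_opp. }
    replace (- (- x + h)) with (x - h) in Heq by ring.
    rewrite Heq, Derive_n_comp_opp by apply Hloc.
    replace (- x + h - - x) with h by ring.
    rewrite (sum_eq _ (fun j => (- h) ^ j / INR (fact j) * Derive_n f j x)).
    2: { intros j _. rewrite Derive_n_comp_opp, Ropp_involutive by apply Hloc.
         replace (- h) with (-1 * h) by ring. rewrite Rpow_mult_distr.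
         unfold Rdiv. ring. }
    match goal with |- Rabs (?a + ?b - ?a) <= _ =>
      replace (a + b - a) with b by ring end.
    rewrite Rabs_mult, (Rabs_pos_eq _ Hr), Rabs_mult, pow_1_abs, Rmult_1_l.
    apply Rmult_le_compat_l; [exact Hr | apply HM; lra].
  (* For [h = 0] only the term [j = 0] survives, as [0 ^ 0 = 1]. *)
  - assert (E : forall m, sum_f_R0 (fun j => (- 0) ^ j / INR (fact j) * Derive_n f j x) m = f x).
    { induction m as [| m IHm].
      - simpl. field.
      - rewrite tech5, IHm, Ropp_0, pow_i by lia. unfold Rdiv. ring. }
    rewrite E, Rminus_0_r, Rminus_diag, Rabs_R0. now apply Rmult_le_pos.
Qed.

Lemma smooth_Derive_n_abs_max (f : R -> R) (n : nat) (a b : R) :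
  smooth f -> a <= b ->
  exists M, is_max_on (fun xi => Rabs (Derive_n f n xi)) a b M.
Proof.
  intros Hf Hab.
  destruct (continuity_ab_maj (fun xi => Rabs (Derive_n f n xi)) a b Hab)
    as [m [Hm Hin]].
  - intros c _. apply (continuity_pt_comp (Derive_n f n) Rabs).
    + apply continuity_pt_filterlim.
      (* The derivative of order [n] is continuous because it is itself differentiable. *)
      exact (ex_derive_continuous (Derive_n f n) c (Hf (S n) c)).
    + apply Rcontinuity_abs.
  - exists (Rabs (Derive_n f n m)). split; [now exists m | exact Hm].
Qed.

Lemma fact_le_pow (n : nat) (b : R) : INR n <= b -> INR (fact n) <= b ^ n.
Proof.
  induction n as [| n IHn]; intro Hb; [simpl; lra |].
  rewrite fact_simpl, mult_INR. simpl pow.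
  assert (INR n <= INR (S n)) by (apply le_INR; lia).
  apply Rmult_le_compat; try apply pos_INR; [exact Hb |].
  apply IHn. lra.
Qed.

(** After exchanging the sums, each Taylor coefficient multiplies a moment of [beta]; only [j = l]
    survives, and its moment [l!] cancels the Taylor denominator. *)
Lemma weighted_taylor_sum (f : R -> R) (beta : nat -> R) (l p : nat) (x delta : R) :
  (l <= p)%nat ->
  (forall j, (j <= p)%nat ->
     sum_f_R0 (fun i => beta i * (- INR i) ^ j) p
     = if Nat.eqb j l then INR (fact l) else 0) ->
  sum_f_R0 (fun i => beta i *
      sum_f_R0 (fun j => (- (INR i * delta)) ^ j / INR (fact j) * Derive_n f j x) p) p
  = Derive_n f l x * delta ^ l.
Proof.
  intros Hl Hbeta.
  set (c := fun j => delta ^ j / INR (fact j) * Derive_n f j x).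
  transitivity (sum_n (fun i => sum_n (fun j => c j * (beta i * (- INR i) ^ j)) p) p).
  { rewrite sum_n_Reals. apply sum_eq. intros i _.
    rewrite sum_n_Reals, scal_sum. apply sum_eq. intros j _. unfold c.
    rewrite Ropp_mult_distr_l, Rpow_mult_distr. unfold Rdiv. ring. }
  rewrite sum_n_switch, sum_n_Reals.
  rewrite (sum_eq _ (fun j => c j * if Nat.eqb j l then INR (fact l) else 0)).
  2: { intros j Hj. rewrite <- (Hbeta j Hj), scal_sum, sum_n_Reals.
       apply sum_eq. intros i _. ring. }
  assert (E : forall q, sum_f_R0 (fun j => c j * if Nat.eqb j l then INR (fact l) else 0) q
    = if Nat.leb l q then c l * INR (fact l) else 0).
  { induction q as [| q IHq].
    - destruct l; simpl; ring.
    - rewrite tech5, IHq.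
      destruct (Nat.leb_spec l q), (Nat.leb_spec l (S q)), (Nat.eqb_spec (S q) l);
        try lia; subst; ring. }
  rewrite E, (proj2 (Nat.leb_le l p) Hl). unfold c.
  field. apply INR_fact_neq_0.
Qed.

Theorem theorem2p10 (l : nat) (hl : (0 < l)%nat) :
  exists beta : nat -> R,
    (forall i : nat, (i <= 2 * l - 1)%nat ->
       Rabs (beta i) <= (2 * INR l) ^ (3 * l)) /\
    forall (f : R -> R) (x delta : R), smooth f -> 0 <= delta ->
      exists M : R,
        is_max_on (fun xi => Rabs (Derive_n f (2 * l) xi))
                  (x - 2 * INR l * delta) x M /\
        Rabs (sum_n (fun i => beta i * f (x - INR i * delta)) (2 * l - 1)
              - Derive_n f l x * delta ^ l)
          <= (2 * INR l) ^ (3 * l + 1) * delta ^ (2 * l) * M.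
Proof.
  destruct (Interpolation.finite_difference_weights (2 * l - 1) l)
    as [beta [Hbound Hmom]].
  set (p := (2 * l - 1)%nat) in *.
  assert (Hp : (2 * l)%nat = S p) by (unfold p; lia).
  assert (HN : 2 * INR l = INR (S p)) by (rewrite <- Hp, mult_INR; reflexivity).
  rewrite HN, Hp.
  set (N := INR (S p)) in *.
  assert (HN0 : 0 <= N) by apply pos_INR.
  assert (Hl : INR (fact l) <= N ^ l).
  { apply fact_le_pow. unfold N. apply le_INR. lia. }
  assert (Hn : INR (fact (S p)) <= N ^ S p) by now apply fact_le_pow, Rle_refl.
  assert (H3 : N ^ (3 * l) = N ^ l * N ^ S p).
  { rewrite <- pow_add. f_equal. lia. }
  exists beta. split.
  { intros i Hi. rewrite H3. apply Rle_trans with (1 := Hbound i Hi).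
    apply Rmult_le_compat; auto using pos_INR. }
  intros f x delta Hf Hdelta.
  assert (Hnd : 0 <= N * delta) by now apply Rmult_le_pos.
  destruct (smooth_Derive_n_abs_max f (S p) (x - N * delta) x Hf) as [M HM]; [lra |].
  exists M. split; [exact HM |].
  destruct HM as [_ HM].
  assert (HM0 : 0 <= M) by (apply Rle_trans with (2 := HM x ltac:(lra)), Rabs_pos).
  rewrite sum_n_Reals.
  rewrite <- (weighted_taylor_sum f beta l p x delta) by (assumption || lia).
  rewrite <- minus_sum.
  apply Rle_trans with (1 := Rsum_abs _ _).
  (* The bound is the same for each of the [S p] terms; their number supplies the last factor
     [N]. *)
  apply Rle_trans with (sum_f_R0 (fun _ => N ^ (3 * l) * delta ^ S p * M) p).
  2: { rewrite sum_cte, pow_add, pow_1. fold N. apply Req_le. ring. }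
  apply sum_Rle. intros i Hi.
  rewrite <- Rmult_minus_distr_l, Rabs_mult.
  assert (HiN : INR i <= N) by (apply le_INR; lia).
  assert (HiNd : INR i * delta <= N * delta) by now apply Rmult_le_compat_r.
  assert (Hid : 0 <= INR i * delta) by (apply Rmult_le_pos; auto using pos_INR).
  assert (Hrem := taylor_left f p x (INR i * delta) M Hf Hid
    (fun xi Hxi => HM xi ltac:(lra))).
  assert (Hfact : 0 < INR (fact (S p))) by apply INR_fact_lt_0.
  (* The sharper weight bound [l! (S p)!] is kept here so that [(S p)!] cancels; the factor
     [N ^ S p] then comes from [INR i <= N]. *)
  apply Rle_trans with (INR (fact l) * INR (fact (S p))
    * ((INR i * delta) ^ S p / INR (fact (S p)) * M)).
  { apply Rmult_le_compat; auto using Rabs_pos. }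
  rewrite Rpow_mult_distr, H3.
  replace (INR (fact l) * INR (fact (S p)) *
    (INR i ^ S p * delta ^ S p / INR (fact (S p)) * M))
    with (INR (fact l) * INR i ^ S p * (delta ^ S p * M))
    by (field; lra).
  rewrite (Rmult_assoc _ (delta ^ S p) M).
  apply Rmult_le_compat_r.
  { apply Rmult_le_pos; [now apply pow_le | exact HM0]. }
  apply Rmult_le_compat; auto using pos_INR, pow_le.
  apply pow_incr. split; [apply pos_INR | exact HiN].
Qed.
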